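(* Let $X$ be a normed vector space over $\mathbb{R}$ with norm $\|\cdot\|$. Let $f:X\to\overline{\mathbb{R}}$ be proper, convex, lower semi-continuous, and specularly Fréchet differentiable at a point $x$ in the interior of $\operatorname{dom}(f)$, with specular Fréchet differential $\widehat{D}f(x)\in X^*$. Then $\widehat{D}f(x)\in\widehat{\partial}f(x)$, where $\widehat{\partial}f(x)$ is the Fréchet subdifferential of $f$ at $x$. If, in addition, $X$ is a reflexive Banach space, then $\widehat{D}f(x)\in\partial f(x)$, where $\partial f(x)$ is the (convex) subdifferential of $f$ at $x$.
   Context: $\overline{\mathbb{R}}:=\mathbb{R}\cup\{-\infty,\infty\}$; $X^*$ is the space of continuous linear functionals on $X$, with duality pairing $\langle\ell,x\rangle:=\ell(x)$. $\operatorname{dom}(f):=\{x\in X: f(x)<\infty\}$; $f$ is proper if $\operatorname{dom}(f)\ne\varnothing$ and $f(x)>-\infty$ for all $x\in X$. For proper $f$ and $x\in\operatorname{dom}(f)$, the Fréchet subdifferential is $$\widehat{\partial}f(x):=\left\{\ell\in X^*:\liminf_{w\to x}\frac{f(w)-f(x)-\langle\ell,w-x\rangle}{\|w-x\|}\ge0\right\}.$$ For proper convex $f$ and $x\in\operatorname{dom}(f)$, the subdifferential is $\partial f(x):=\{\ell\in X^*: f(w)\ge f(x)+\langle\ell,w-x\rangle\text{ for all }w\in X\}$. The norm on $X\times\mathbb{R}$ is $\|(x,y)\|_{X\times\mathbb{R}}:=(\|x\|^2+|y|^2)^{1/2}$. $f$ (which is real-valued near the interior point $x$ of $\operatorname{dom}(f)$)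 is specularly Fréchet differentiable at $x$ if there exists $\ell\in X^*$ such that $$\lim_{\|w\|\to 0}\left|\frac{f(x+w)-f(x)-\ell(w)}{\|w\|}\cdot\frac{\|J\|_{X\times\mathbb{R}}}{\|J\|_{X\times\mathbb{R}}+\|K\|_{X\times\mathbb{R}}}+\frac{f(x)-f(x-w)-\ell(w)}{\|w\|}\cdot\frac{\|K\|_{X\times\mathbb{R}}}{\|J\|_{X\times\mathbb{R}}+\|K\|_{X\times\mathbb{R}}}\right|=0$$ (limit over nonzero $w\in X$), where $J:=(w,f(x)-f(x-w))$ and $K:=(w,f(x+w)-f(x))$. Such an $\ell$ is called the specular Fréchet differential of $f$ at $x$ and is denoted $\widehat{D}f(x)$. *)

(* Defs.v *)
From HB Require Import structures.
From mathcomp Require Import all_boot all_order all_algebra.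
From mathcomp Require Import all_classical all_reals all_analysis.

Set Implicit Arguments.
Unset Strict Implicit.
Unset Printing Implicit Defensive.

Import Order.TTheory GRing.Theory Num.Theory.
Import numFieldNormedType.Exports.

Local Open Scope classical_set_scope.
Local Open Scope ring_scope.

(** X^* as a subtype of the function space X -> R, normed by the
    operator norm. *)
Section dual.
Context {R : realType} (X : normedModType R).

Definition continuous_linear : {pred X -> R^o} :=
  [pred f : X -> R^o | `[< linear f /\ continuous f >]].

Record dual := Dual {
  dual_fun :> X -> R^o ;
  dual_funP : dual_fun \in continuous_linear }.

HB.instance Definition _ := [isSub for dual_fun].
HB.instance Definition _ := [Choice of dual by <:].

Lemma continuous_linear_submod_closed : submod_closed continuous_linear.
Proof.
split.
  apply/asboolP; split; last exact: cst_continuous.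
  by move=> a u v; rewrite /GRing.zero/= scaler0 addr0.
move=> a f g /asboolP[lf cf] /asboolP[lg cg]; apply/asboolP; split.
  move=> b u v; rewrite !fctE lf lg !scalerDr !scalerA [a * b]mulrC.
  by rewrite addrACA.
move=> x; apply: cvgD; last exact: cg.
by apply: cvgZl_tmp; exact: cf.
Qed.

HB.instance Definition _ := GRing.isSubmodClosed.Build R (X -> R^o)
  continuous_linear continuous_linear_submod_closed.
HB.instance Definition _ := [SubChoice_isSubLmodule of dual by <:].

Lemma dual_linear (l : dual) : linear l.
Proof. by have /asboolP[] := dual_funP l. Qed.

Lemma dual_continuous (l : dual) : continuous l.
Proof. by have /asboolP[] := dual_funP l. Qed.

HB.instance Definition _ (l : dual) :=
  GRing.isLinear.Build R X R^o *:%R (dual_fun l) (dual_linear l).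

Definition opnorm (l : dual) : R := sup [set `|l x| | x in [set x | `|x| <= 1]].

Lemma opnorm_has_sup (l : dual) :
  has_sup [set `|l x| | x in [set x | `|x| <= 1]].
Proof.
split; first by exists `|l 0|, 0 => //=; rewrite normr0.
have /linear_boundedP : bounded_near (l : {linear X -> R^o}) (nbhs (0 : X)).
  exact/linear_bounded_continuous/dual_continuous.
move=> /pinfty_ex_gt0[M M0 HM]; exists M => _ [x /= x1 <-].
by rewrite (le_trans (HM x))// ler_piMr// ltW.
Qed.

Lemma opnorm_ub (l : dual) x : `|x| <= 1 -> `|l x| <= opnorm l.
Proof. by move=> x1; apply: sup_upper_bound; [exact: opnorm_has_sup|exists x]. Qed.

Lemma opnorm_ge0 (l : dual) : 0 <= opnorm l.
Proof. by rewrite (le_trans _ (@opnorm_ub l 0 _))// normr0. Qed.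

Lemma opnorm_le (l : dual) M :
  (forall x, `|x| <= 1 -> `|l x| <= M) -> opnorm l <= M.
Proof.
move=> lM; apply: ge_sup; first by case: (opnorm_has_sup l).
by move=> _ [x /= x1 <-]; exact: lM.
Qed.

Lemma le_opnorm (l : dual) x : `|l x| <= opnorm l * `|x|.
Proof.
have [->|x0] := eqVneq x 0; first by rewrite linear0 !normr0 mulr0.
have nx0 : 0 < `|x| by rewrite normr_gt0.
rewrite -ler_pdivrMr//.
have -> : `|l x| / `|x| = `|l (`|x|^-1 *: x)|.
  by rewrite linearZ/= normrM mulrC ger0_norm// invr_ge0 ltW.
by apply: opnorm_ub; rewrite normrZ normfV normr_id mulVf// gt_eqF.
Qed.

Lemma ler_opnormD (l m : dual) : opnorm (l + m) <= opnorm l + opnorm m.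
Proof.
apply: opnorm_le => x x1.
by rewrite (le_trans (ler_normD _ _))// lerD// opnorm_ub.
Qed.

Lemma opnormZ_le (a : R) (l : dual) : opnorm (a *: l) <= `|a| * opnorm l.
Proof.
by apply: opnorm_le => x x1; rewrite normrM ler_wpM2l// opnorm_ub.
Qed.

Lemma opnormZ (a : R) (l : dual) : opnorm (a *: l) = `|a| * opnorm l.
Proof.
apply/eqP; rewrite eq_le opnormZ_le/=.
have [->|a0] := eqVneq a 0; first by rewrite normr0 mul0r opnorm_ge0.
rewrite -[in leLHS](scale1r l) -(mulVf a0) -scalerA.
rewrite (le_trans (ler_wpM2l (normr_ge0 a) (opnormZ_le _ _)))//.
by rewrite mulrA -normrM mulfV// normr1 mul1r.
Qed.

Lemma opnorm_eq0 (l : dual) : opnorm l = 0 -> l = 0.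
Proof.
move=> l0; apply: val_inj; apply/funext => x /=.
by apply/normr0_eq0/le_anti; rewrite normr_ge0 andbT -(mul0r `|x|) -l0 le_opnorm.
Qed.

HB.instance Definition _ := Lmodule_isNormed.Build R dual
  ler_opnormD opnormZ opnorm_eq0.

End dual.

Section bidual.
Context {R : realType} (X : normedModType R).

Lemma bidual_eval_subproof (x : X) :
  (fun l : dual X => l x) \in continuous_linear (X := dual X).
Proof.
apply/asboolP.
have lin : linear (fun l : dual X => l x : R^o) by move=> a l m.
split => //.
pose ev := HB.pack_for {linear dual X -> R^o} (fun l : dual X => l x : R^o)
  (GRing.isLinear.Build R (dual X) R^o *:%R (fun l : dual X => l x) lin).
apply: (@bounded_linear_continuous _ _ _ ev); apply/linear_boundedP.
near=> r => l; rewrite (le_trans (le_opnorm l x))// mulrC ler_wpM2r//.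
exact: opnorm_ge0.
Unshelve. all: by end_near. Qed.

Definition bidual_eval (x : X) : dual (dual X) := Dual (bidual_eval_subproof x).

(* the canonical embedding is always an isometry, so only surjectivity counts *)
Definition reflexive_space := forall Phi : dual (dual X),
  exists x : X, bidual_eval x = Phi.

Definition banach_space :=
  forall F : set_system X, ProperFilter F -> cauchy F -> cvg F.

End bidual.

Section subdifferentials.
Context {R : realType} (X : normedModType R).
Implicit Types (f : X -> \bar R) (x : X) (l : dual X).
Local Open Scope ereal_scope.

Definition dom f : set X := [set x | f x < +oo].

Definition proper_fun f := dom f !=set0 /\ forall x, -oo < f x.

(* [convex_function] of the library is restricted to real-valued functions *)
Definition econvex_fun f := forall (x y : X) (t : R), (0 <= t <= 1)%R ->
  f (t *: x + (1 - t) *: y)%R <= t%:E * f x + (1 - t)%:E * f y.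

Definition frechet_subdifferential f x : set (dual X) :=
  [set l | 0 <= limf_einf
    (fun w => (f w - f x - (l (w - x)%R)%:E) * (`|w - x|^-1)%:E) x^'].

Definition convex_subdifferential f x : set (dual X) :=
  [set l | forall w, f x + (l (w - x)%R)%:E <= f w].

End subdifferentials.

Section specular.
Context {R : realType} (X : normedModType R).
Implicit Types (f : X -> \bar R) (x : X) (l : dual X).

(* the library's norm on X * R is the max norm *)
Definition norm2 (p : X * R) : R := Num.sqrt (`|p.1| ^+ 2 + `|p.2| ^+ 2).

(* [fine] is harmless: for proper f and x interior to dom f, both f (x + w)
   and f (x - w) are finite once w is small. *)
Definition specular_frechet_differential f x l :=
  let g := fine \o f in
  let J w := norm2 (w, g x - g (x - w)) in
  let K w := norm2 (w, g (x + w) - g x) in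
  (fun w : X =>
     `| (g (x + w) - g x - l w) / `|w| * (J w / (J w + K w))
      + (g x - g (x - w) - l w) / `|w| * (K w / (J w + K w)) |)
    @ (0 : X)^' --> (0 : R).

End specular.

(* Main.v *)
Require Import Defs.
From mathcomp Require Import all_boot all_order all_algebra.
From mathcomp Require Import all_classical all_reals all_analysis.
From mathcomp Require Import lra.

Set Implicit Arguments.
Unset Strict Implicit.
Unset Printing Implicit Defensive.

Import Order.TTheory GRing.Theory Num.Theory.
Import numFieldNormedType.Exports.

Local Open Scope classical_set_scope.
Local Open Scope ring_scope.

(** The proof compares difference quotients along rays from x. Write
    A w = f (x + w) - f x and B w = f x - f (x - w). The specular quotient
    is a weighted mean, with nonnegative weights of sum 1, of
    (A w - l w) / `|w| and (B w - l w) / `|w|. By convexity B w <= A w, so the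
    forward quotient (A w - l w) / `|w| dominates the whole mean.

    If the subgradient inequality failed at x + v, say A v <= l v - c with
    c > 0, then convexity would propagate the failure down the segment:
    A (t v) <= l (t v) - t c for 0 < t <= 1. The forward quotient at t v, and
    with it the mean, would be at most - c / `|v|; this contradicts the
    convergence of the mean to 0 as t tends to 0. Hence l is a convex
    subgradient (specular_convex_subdifferential).

    A convex subgradient is a Frechet subgradient because it makes every
    difference quotient nonnegative (convex_sub_frechet_subdifferential). *)

Section convex_subgradients.
Context {R : realType} (X : normedModType R).
Implicit Types (f : X -> \bar R) (x v w y z : X) (l : dual X).

(** The extended-valued convexity inequality turned into a real one, so that
    it can be combined with the real-valued specular quotient. *)
Lemma econvex_fun_fine f y z (t : R) : proper_fun f -> econvex_fun f ->
  f y \is a fin_num -> f z \is a fin_num -> 0 <= t <= 1 ->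
  f (t *: y + (1 - t) *: z) \is a fin_num /\
  fine (f (t *: y + (1 - t) *: z)) <= t * fine (f y) + (1 - t) * fine (f z).
Proof.
move=> [_ fgt] cf fy fz t01; have := cf y z t t01.
rewrite -(fineK fy) -(fineK fz) -!EFinM -EFinD => fle.
have ffin : f (t *: y + (1 - t) *: z) \is a fin_num.
  by rewrite fin_numElt fgt/= (le_lt_trans fle)// ltry.
by split=> //; rewrite -lee_fin (fineK ffin).
Qed.

Lemma proper_dom_fin_num f y : proper_fun f -> dom f y -> f y \is a fin_num.
Proof. by move=> [_ fgt] fy; rewrite fin_numElt fgt. Qed.

(** Midpoint convexity: the backward difference is at most the forward one. *)
Lemma econvex_fun_backward_le_forward f x w : proper_fun f -> econvex_fun f ->
  f (x + w) \is a fin_num -> f (x - w) \is a fin_num ->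
  fine (f x) - fine (f (x - w)) <= fine (f (x + w)) - fine (f x).
Proof.
move=> pf cf fp fm.
have half01 : 0 <= (2^-1 : R) <= 1 by lra.
have [_] := econvex_fun_fine pf cf fp fm half01.
have -> : 2^-1 *: (x + w) + (1 - 2^-1) *: (x - w) = x.
  have -> : 1 - 2^-1 = 2^-1 :> R by lra.
  rewrite -scalerDr addrACA subrr addr0 -mulr2n -(scaler_nat 2 x) scalerA.
  by rewrite mulVf ?pnatr_eq0// scale1r.
by lra.
Qed.

Lemma weighted_mean_le (p q m a b : R) : p <= m -> q <= m ->
  0 <= a -> 0 <= b -> 0 < a + b ->
  p * (a / (a + b)) + q * (b / (a + b)) <= m.
Proof.
move=> pm qm a0 b0 ab0; rewrite !mulrA -mulrDl ler_pdivrMr// mulrDr.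
by apply: lerD; apply: ler_wpM2r.
Qed.

(** As w != 0, both norms are positive, so the two quotients are averaged with
    weights of sum 1; the larger one is the forward quotient. *)
Lemma specular_quotient_le (w : X) (a b lw m : R) : w != 0 -> b <= a ->
  (a - lw) / `|w| <= m ->
  (a - lw) / `|w| * (norm2 (w, b) / (norm2 (w, b) + norm2 (w, a))) +
  (b - lw) / `|w| * (norm2 (w, a) / (norm2 (w, b) + norm2 (w, a))) <= m.
Proof.
move=> w0 ba am.
have norm2_gt0 c : 0 < norm2 (w, c).
  by rewrite sqrtr_gt0/= ltr_pwDl ?sqr_ge0// exprn_gt0// normr_gt0.
apply: weighted_mean_le => //; [|exact: ltW|exact: ltW|exact: addr_gt0].
by rewrite (le_trans _ am)// ler_wpM2r ?invr_ge0// lerD2r.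
Qed.

(** Convexity propagates a failure of the subgradient inequality at x + v
    along the whole segment: both sides of the inequality scale with t, so the
    forward quotient stays below the fixed negative bound - c / `|v|. *)
Lemma specular_quotient_segment_le f x v l (t c : R) :
  let g := fine \o f in let w := t *: v in
  proper_fun f -> econvex_fun f ->
  f x \is a fin_num -> f (x + v) \is a fin_num -> f (x - w) \is a fin_num ->
  v != 0 -> 0 < t <= 1 -> g (x + v) - g x - l v <= - c ->
  let J := norm2 (w, g x - g (x - w)) in
  let K := norm2 (w, g (x + w) - g x) in
  (g (x + w) - g x - l w) / `|w| * (J / (J + K))
    + (g x - g (x - w) - l w) / `|w| * (K / (J + K)) <= - c / `|v|.
Proof.
move=> g w pf cf fx fv fm v0 /andP[t0 t1] vc /=.
have t01 : 0 <= t <= 1 by rewrite (ltW t0).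
have [] := econvex_fun_fine pf cf fv fx t01.
have -> : t *: (x + v) + (1 - t) *: x = x + w.
  by rewrite scalerDr scalerBl scale1r addrAC [t *: x + _]addrC subrK addrC.
move=> fp gle; apply: specular_quotient_le.
- by rewrite scaler_eq0 negb_or gt_eqF.
- exact: econvex_fun_backward_le_forward.
- have nv : 0 < `|v| by rewrite normr_gt0.
  rewrite linearZ/= normrZ gtr0_norm// ler_pdivrMr ?mulr_gt0//.
  rewrite mulrCA -mulrA mulVf ?gt_eqF// mulr1.
  have := ler_wpM2l (ltW t0) vc; rewrite /g /= /GRing.scale/=; lra.
Qed.

(** Follow the segment from x to a point z violating the subgradient
    inequality: the specular quotient is bounded away from 0 arbitrarily close
    to x. *)
Lemma specular_convex_subdifferential f x l :
  proper_fun f -> econvex_fun f -> (dom f)° x ->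
  specular_frechet_differential f x l -> convex_subdifferential f x l.
Proof.
move=> pf cf xdom spec z; rewrite leNgt; apply/negP.
have fx : f x \is a fin_num.
  by apply: proper_dom_fin_num => //; exact: interior_subset xdom.
pose v := z - x; have zE : z = x + v by rewrite addrC subrK.
rewrite -/v zE => flt.
have fv : f (x + v) \is a fin_num.
  apply: proper_dom_fin_num => //; rewrite /dom/= (lt_trans flt)//.
  by rewrite -(fineK fx) -EFinD ltry.
have v0 : v != 0.
  by apply/eqP => v0; move: flt; rewrite v0 linear0 addr0 adde0 ltxx.
pose c := l v - (fine (f (x + v)) - fine (f x)).
have c0 : 0 < c.
  by move: flt; rewrite -(fineK fx) -(fineK fv) -EFinD lte_fin /c; lra.
have cv0 : 0 < c / `|v| by rewrite divr_gt0// normr_gt0.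
have tv0 : t *: v @[t --> 0^'+] --> (0 : X).
  rewrite -(scale0r v); apply: cvgZr_tmp.
  exact: (@cvg_at_right_filter R R id).
have tv0' : t *: v @[t --> 0^'+] --> (0 : X)^'.
  move=> A Apunct.
  have : \forall t \near 0^'+, t *: v != 0 -> A (t *: v) := tv0 _ Apunct.
  apply: filterS2 (nbhs_right_gt 0) => t t0; apply.
  by rewrite scaler_eq0 negb_or gt_eqF.
have xtv : x - t *: v @[t --> 0^'+] --> x.
  rewrite -[X in _ --> X]subr0; apply: cvgB => //; exact: cvg_cst.
have domt : \forall t \near 0^'+, dom f (x - t *: v) := xtv _ xdom.
have /cvgr0_norm_lt/(_ _ cv0) small := cvg_comp _ _ tv0' spec.
(* The interior hypothesis makes f (x - t v) finite for small t, and the limit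
   brings the quotient within c / `|v| of 0. *)
have [t [[/(proper_dom_fin_num pf) fm tsmall] [t0 t1]]] := filter_ex
  (filterI (filterI domt small) (filterI (nbhs_right_gt 0) (nbhs_right_le ltr01))).
have t01 : 0 < t <= 1 by rewrite t0.
have vc : (fine \o f) (x + v) - (fine \o f) x - l v <= - c by rewrite /c/=; lra.
have := specular_quotient_segment_le pf cf fx fv fm v0 t01 vc.
apply/negP; rewrite -ltNge mulNr.
by move: tsmall; rewrite /= normr_id ltr_norml => /andP[].
Qed.

(** The subgradient inequality makes every difference quotient nonnegative (at
    w = x the quotient is 0, since 0^-1 = 0), hence so is its infimum over the
    whole space, which bounds the lower limit from below. *)
Lemma convex_sub_frechet_subdifferential f x l :
  f x \is a fin_num ->
  convex_subdifferential f x l -> frechet_subdifferential f x l.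
Proof.
move=> fx lsub; rewrite /frechet_subdifferential/= limf_einfE.
apply: (@le_trans _ _ (ereal_inf
  [set ((f w - f x - (l (w - x))%:E) * (`|w - x|^-1)%:E)%E | w in [set: X]])).
  apply/ereal_infP => _ [w _ <-]; apply: mule_ge0.
    have := lsub w; rewrite -(fineK fx).
    by case: (f w) => [r||]//=; rewrite -?EFinD ?lee_fin ?leey//; lra.
  by rewrite lee_fin invr_ge0.
by apply: ereal_sup_ubound; exists setT => //; exact: filterT.
Qed.

End convex_subgradients.

Theorem theorem5p7 (R : realType) (X : normedModType R) (f : X -> \bar R)
    (x : X) (Df : dual X) :
  proper_fun f -> econvex_fun f -> lower_semicontinuous f ->
  (dom f)° x -> specular_frechet_differential f x Df ->
  frechet_subdifferential f x Df /\
  (banach_space X -> reflexive_space X -> convex_subdifferential f x Df).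
Proof.
move=> pf cf _ xdom spec.
have csub := specular_convex_subdifferential pf cf xdom spec.
split=> //; apply: convex_sub_frechet_subdifferential => //.
by apply: proper_dom_fin_num => //; exact: interior_subset xdom.
Qed.
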